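(* Let $n\ge1$ and let $\gamma_{n,k}^S$ be the integers defined by $$\sum_{\pi\in\mathfrak{S}_n(2413,3142)}t^{\mathrm{des}(\pi)}=\sum_{k=0}^{\lfloor\frac{n-1}{2}\rfloor}\gamma_{n,k}^S\, t^k (1+t)^{n-1-2k}.$$ Then $$\gamma_{n,k}^S=\sum_{T\in\mathfrak{T}_n,\ r_{o}(T)=n-1-2k} 2^{r_{e}(T)}.$$
   Context: $\mathfrak{S}_n(2413,3142)$ is the set of permutations of $[n]$ avoiding the patterns $2413$ and $3142$; $\mathrm{des}(\pi)=\#\{i\in[n-1]:\pi_i>\pi_{i+1}\}$. A binary tree is either empty or consists of a root with a left and a right subtree, both binary trees; $\mathfrak{T}_n$ is the set of (unlabelled) binary trees with $n-1$ nodes. A right chain of a binary tree is a maximal sequence of nodes $v_1,\dots,v_l$ with $v_1$ the root or a left child and each $v_{j+1}$ the right child of $v_j$; $l$ is its length. $r_o(T)$ and $r_e(T)$ are the numbers of right chains of $T$ of odd and even length respectively. *)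

(* Defs.v *)
From HB Require Import structures.
From mathcomp Require Import all_boot all_order all_fingroup all_algebra.
Set Implicit Arguments. Unset Strict Implicit. Unset Printing Implicit Defensive.
Import GRing.Theory.

(* Permutations of [n] are 'S_n (permutations of 'I_n = {0,...,n-1}).
   A pattern is given as a 0-indexed sequence, e.g. 2413 ~ [:: 1; 3; 0; 2]. *)

Definition contains (n : nat) (s : 'S_n) (p : seq nat) : bool :=
  [exists f : {ffun 'I_(size p) -> 'I_n},
     [forall a : 'I_(size p), forall b : 'I_(size p),
        ((a < b)%N ==> (f a < f b)%N) &&
        ((s (f a) < s (f b))%N == (nth 0 p a < nth 0 p b)%N)]].

Definition pat2413 : seq nat := [:: 1; 3; 0; 2].
Definition pat3142 : seq nat := [:: 2; 0; 3; 1].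

Definition avoids_2413_3142 (n : nat) (s : 'S_n) : bool :=
  ~~ contains s pat2413 && ~~ contains s pat3142.

Definition des (n : nat) (s : 'S_n) : nat :=
  #|[set i : 'I_n | [exists j : 'I_n, (val j == i.+1) && (s j < s i)%N]]|.

Local Open Scope ring_scope.

Definition des_poly (n : nat) : {poly int} :=
  \sum_(s : 'S_n | avoids_2413_3142 s) 'X ^+ des s.

Definition gamma_expansion (n : nat) (gamma : nat -> int) : {poly int} :=
  \sum_(k < ((n.-1)./2).+1)
     (gamma k)%:P * 'X ^+ k * (1 + 'X) ^+ (n.-1 - k.*2)%N.

Local Close Scope ring_scope.

Inductive btree : Type := Leaf | Node of btree & btree.

Fixpoint btree_eqb (t u : btree) : bool :=
  match t, u with
  | Leaf, Leaf => true
  | Node l r, Node l' r' => btree_eqb l l' && btree_eqb r r'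
  | _, _ => false
  end.

Lemma btree_eqP : Equality.axiom btree_eqb.
Proof.
elim=> [|l IHl r IHr] [|l' r'] /=; try by constructor.
by apply: (iffP andP) => [[/IHl -> /IHr ->]|[<- <-]]; split; [apply/IHl|apply/IHr].
Qed.

HB.instance Definition _ := hasDecEq.Build btree btree_eqP.

Fixpoint nnodes (t : btree) : nat :=
  match t with Leaf => 0 | Node l r => (nnodes l + nnodes r).+1 end.

Fixpoint spine (t : btree) : nat :=
  match t with Leaf => 0 | Node _ r => (spine r).+1 end.

(* lengths of the right chains whose first node lies in t;
   [head] says whether the root of t starts a chain (it is the root of the
   whole tree or a left child) or not (it is a right child). *)
Fixpoint chains_in (head : bool) (t : btree) : seq nat :=
  match t with
  | Leaf => [::]
  | Node l r => (if head then [:: spine t] else [::])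
                ++ chains_in true l ++ chains_in false r
  end.

Definition right_chains (t : btree) : seq nat := chains_in true t.

Definition r_o (t : btree) : nat := count odd (right_chains t).
Definition r_e (t : btree) : nat := count (fun l => ~~ odd l) (right_chains t).

Definition gammaT (n : nat) (ts : seq btree) (k : nat) : nat :=
  \sum_(t <- ts | r_o t == n.-1 - k.*2) 2 ^ r_e t.

(* Main.v *)
Require Import Defs.
From mathcomp Require Import all_boot all_order all_fingroup all_algebra.
From mathcomp Require Import zify ring.
Set Implicit Arguments. Unset Strict Implicit. Unset Printing Implicit Defensive.
Import GRing.Theory.

(* A separable permutation of size at least 2 is either direct or skew
   decomposable, and never both. Splitting at the first cut, the descent
   generating function S = sum_n S_n x^n of separable permutations satisfies
   S = x + P + M with P = (S - P) S (direct sums) and M = t (S - M) S (skew sums),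
   hence (1 - t S^2) S = x (1 + S) (1 + t S).
   A right chain of length l weighs (1 + t) t^((l-1)/2) or 2 t^(l/2) according to
   its parity; cutting a tree at its root, the generating function T of all trees
   and those O, E of the trees with odd and even root chain (that chain
   weighing only t^(l/2) with l/2 rounded down) satisfy O = x T E,
   E = 1 + t x T O and T = (1 + t) O + 2 E - 1. So x T solves the
   same equation as S, and that equation has only one solution without constant
   term. Power series are polynomials over {poly int} modulo x^N. *)

(* [lia] does not identify [nat] with the carrier of its [eqType]. *)
Ltac nlia :=
  change (Equality.sort Datatypes_nat__canonical__eqtype_Equality) with nat in *; lia.

(** * Words over the naturals: patterns, cuts and steps *)

(* For [r = gtn] this is an occurrence of 2413. *)
Definition occurs3142 (r : rel nat) (s : seq nat) (i j k l : nat) : bool :=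
  [&& i < j, j < k, k < l, l < size s, r (nth 0 s j) (nth 0 s l),
      r (nth 0 s l) (nth 0 s i) & r (nth 0 s i) (nth 0 s k)].

Definition avoids3142 (r : rel nat) (s : seq nat) : bool :=
  ~~ [exists i : 'I_(size s), exists j : 'I_(size s), exists k : 'I_(size s),
      exists l : 'I_(size s), occurs3142 r s i j k l].

Definition separable (s : seq nat) : bool := avoids3142 ltn s && avoids3142 gtn s.

(** The index is the position of the last letter of the left block, so the indices below
    [(size s).-1] are exactly the cuts into two nonempty blocks. *)
Definition cut_at (r : rel nat) (s : seq nat) (i : nat) : bool :=
  allrel r (take i.+1 s) (drop i.+1 s).

Definition decomposable (r : rel nat) (s : seq nat) : bool :=
  has (cut_at r s) (iota 0 (size s).-1).

Definition steps (r : rel nat) (s : seq nat) : nat :=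
  if s is x :: s' then count id (pairmap r x s') else 0.

Lemma avoids3142P (r : rel nat) (s : seq nat) :
  reflect (forall i j k l, ~~ occurs3142 r s i j k l) (avoids3142 r s).
Proof.
apply: (iffP idP) => [H i j k l|H]; last first.
  apply/existsPn => i; apply/existsPn => j; apply/existsPn => k.
  by apply/existsPn => l; apply: H.
apply: contra H => Ho; case/and5P: (Ho) => ij jk kl ls _.
have ks := ltn_trans kl ls; have js := ltn_trans jk ks; have is_ := ltn_trans ij js.
apply/existsP; exists (Ordinal is_); apply/existsP; exists (Ordinal js).
by apply/existsP; exists (Ordinal ks); apply/existsP; exists (Ordinal ls).
Qed.

Section OrderTransport.
Variables (r r' : rel nat) (g : nat -> nat) (s : seq nat).
Hypothesis g_mono : {in s &, forall x y, r' (g x) (g y) = r x y}.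

(** Here [g] will be a shift, with [r'] equal to [r], or the complement, with [r'] the converse of
    [r]. Monotonicity is local to [s] because truncated subtraction reverses the order only up to
    its bound. *)
Lemma avoids3142_map : avoids3142 r' (map g s) = avoids3142 r s.
Proof.
have E i j k l : occurs3142 r' (map g s) i j k l = occurs3142 r s i j k l.
  rewrite /occurs3142 size_map.
  case ij: (i < j); case jk: (j < k); case kl: (k < l); case ls: (l < size s) => //=.
  have ks := ltn_trans kl ls; have js := ltn_trans jk ks; have is_ := ltn_trans ij js.
  by rewrite !(nth_map 0) // !g_mono // mem_nth.
by apply/avoids3142P/avoids3142P => H i j k l; [rewrite -E | rewrite E].
Qed.

Lemma decomposable_map : decomposable r' (map g s) = decomposable r s.
Proof.
rewrite /decomposable size_map; apply: eq_in_has => i _.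
rewrite /cut_at -map_take -map_drop allrel_mapl allrel_mapr.
apply/allrelP/allrelP => H x y xs ys; have := H x y xs ys;
  by rewrite g_mono // ?(mem_take xs) ?(mem_drop ys).
Qed.

Lemma steps_map : steps r' (map g s) = steps r s.
Proof.
case: s g_mono => [//|x s1] /=.
elim: s1 x => [//|y s1 IH] x gm /=.
rewrite gm ?inE ?eqxx ?orbT // IH // => u v us vs.
by apply: gm; rewrite inE ?us ?vs orbT.
Qed.
End OrderTransport.

Lemma steps_cat (r : rel nat) (x : nat) s (y : nat) t :
  steps r ((x :: s) ++ y :: t) = steps r (x :: s) + r (last x s) y + steps r (y :: t).
Proof. by rewrite /= pairmap_cat count_cat /= addnA. Qed.

Lemma avoids3142_catl r (s t : seq nat) : avoids3142 r (s ++ t) -> avoids3142 r s.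
Proof.
move/avoids3142P => H; apply/avoids3142P => i j k l; apply: contra (H i j k l).
case/and5P=> ij jk kl ls hr; rewrite /occurs3142 ij jk kl size_cat ltn_addr //=.
have ks := ltn_trans kl ls; have js := ltn_trans jk ks; have is_ := ltn_trans ij js.
by rewrite !nth_cat ls ks js is_.
Qed.

Lemma avoids3142_catr r (s t : seq nat) : avoids3142 r (s ++ t) -> avoids3142 r t.
Proof.
move/avoids3142P => H; apply/avoids3142P => i j k l.
apply: contra (H (size s + i) (size s + j) (size s + k) (size s + l)).
by rewrite /occurs3142 !ltn_add2l size_cat ltn_add2l !nth_cat !ltnNge !leq_addr /= !addKn.
Qed.

(** Neither pattern can straddle the border. The last letter of 3142 is below the first. In 2413, if
    the 1 lies in [s] then so does the 4, which exceeds the 3 in [t]; otherwise the 1 lies in [t],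
    yet below the 2 in [s]. *)
Lemma separable_cat (s t : seq nat) :
  allrel ltn s t -> separable (s ++ t) = separable s && separable t.
Proof.
move=> st; apply/idP/idP.
  case/andP=> a b; rewrite /separable.
  by rewrite (avoids3142_catl a) (avoids3142_catl b) (avoids3142_catr a) (avoids3142_catr b).
have lt_st u v : u < size s -> size s <= v -> v < size (s ++ t) ->
    nth 0 (s ++ t) u < nth 0 (s ++ t) v.
  rewrite size_cat !nth_cat => us sv; rewrite us (ltnNge v (size s)) sv /= => vt.
  by apply: (allrelP st); rewrite mem_nth // ltn_subLR.
have tr r i j k l : occurs3142 r (s ++ t) i j k l ->
    [|| occurs3142 r s i j k l,
     occurs3142 r t (i - size s) (j - size s) (k - size s) (l - size s)
     | (i < size s) && (size s <= l)].
  case: (ltnP l (size s)) => ls; rewrite ?andbF ?orbF.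
    case/and5P=> ij jk kl lst; rewrite /occurs3142 ij jk kl ls /=.
    have ks := ltn_trans kl ls; have js := ltn_trans jk ks; have is_ := ltn_trans ij js.
    by rewrite !nth_cat ls ks js is_ => ->.
  case: (ltnP i (size s)) => is_; first by rewrite !orbT.
  case/and5P=> ij jk kl lst.
  have js : size s <= j by nlia.
  have ks : size s <= k by nlia.
  rewrite !nth_cat !ltnNge ls ks js is_ /= => h; apply/orP; right; rewrite orbF.
  rewrite /occurs3142 h !andbT; move: lst; rewrite size_cat; nlia.
case/andP=> /andP[/avoids3142P sl /avoids3142P sg] /andP[/avoids3142P tl /avoids3142P tg].
apply/andP; split; apply/avoids3142P => i j k l; apply/negP => H.
  move: (tr _ _ _ _ _ H); rewrite (negbTE (sl _ _ _ _)) (negbTE (tl _ _ _ _)) /=.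
  case/andP=> is_ ls; case/and5P: H => _ _ _ lst /and3P[_ /= a _].
  by move: (lt_st _ _ is_ ls lst) a; rewrite ltnNge => /negP h /ltnW.
move: (tr _ _ _ _ _ H); rewrite (negbTE (sg _ _ _ _)) (negbTE (tg _ _ _ _)) /=.
case/andP=> is_ ls; case/and5P: H => ij jk kl lst /and3P[/= a _ b].
case: (ltnP k (size s)) => ks.
  have := lt_st _ _ (ltn_trans jk ks) ls lst; nlia.
have := lt_st _ _ is_ ks (ltn_trans kl lst); nlia.
Qed.

(** * Decomposability of separable words *)

Lemma decomposableP (r : rel nat) (s : seq nat) :
  reflect (exists a b, [/\ s = a ++ b, a != [::], b != [::] & allrel r a b]) (decomposable r s).
Proof.
apply: (iffP hasP) => [[i]|[a [b [-> a0 b0 ab]]]].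
  rewrite mem_iota add0n /cut_at => /andP[_ is_] ab.
  exists (take i.+1 s), (drop i.+1 s); split=> //; first by rewrite cat_take_drop.
  - rewrite -size_eq0 size_take; case: ifP; nlia.
  by rewrite -size_eq0 size_drop; nlia.
case: a a0 ab => [//|x a] _ ab; exists (size a).
  rewrite mem_iota size_cat /=; case: b b0 {ab} => //= y b _; nlia.
by rewrite /cut_at take_size_cat // drop_size_cat.
Qed.

Lemma occurs_avoids (r : rel nat) (s1 s2 s3 s4 : seq nat) (a b c d : nat) :
  a \in s1 -> b \in s2 -> c \in s3 -> d \in s4 -> r b d -> r d a -> r a c ->
  ~~ avoids3142 r (s1 ++ s2 ++ s3 ++ s4).
Proof.
move=> as1 bs2 cs3 ds4 bd da ac; apply/avoids3142P.
move=> /(_ (index a s1) (size s1 + index b s2) (size s1 + (size s2 + index c s3))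
  (size s1 + (size s2 + (size s3 + index d s4)))) /negP; apply.
rewrite /occurs3142 !nth_cat !size_cat !ltn_add2l.
have addlF m n : (m + n < m) = false by lia.
rewrite !(addlF, addKn) !index_mem as1 bs2 cs3 ds4.
rewrite !nth_index // bd da ac !andbT.
move: as1 bs2 cs3 ds4; rewrite -!index_mem; nlia.
Qed.

(** [above ltn] is convertible to [gtn] and [above gtn] to [ltn], so the next lemma serves direct
    and skew cuts alike. *)
Definition above (r : rel nat) : rel nat := fun x y => r y x.

(** Let [a] be the left block of the first cut of [s]. If [v] is above all of [a], that cut
    survives; if [v] is below all of [s], there is a new cut before [v]; otherwise [a] decomposes
    the other way and the pattern occurs. *)
Lemma decomposable_rcons (r : rel nat) (s : seq nat) (v : nat) :
  transitive r -> (forall x y, x != y -> r x y || r y x) ->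
  (forall s', size s' <= size s -> 1 < size s' -> uniq s' ->
    avoids3142 r s' -> avoids3142 (above r) s' -> decomposable r s' || decomposable (above r) s') ->
  uniq (rcons s v) -> avoids3142 r (rcons s v) -> avoids3142 (above r) (rcons s v) ->
  decomposable r s -> decomposable r (rcons s v) || decomposable (above r) (rcons s v).
Proof.
move=> tr tot IH us av av' spl.
have exn : exists i, (i < (size s).-1) && cut_at r s i.
  by case/hasP: spl => i; rewrite mem_iota => /= hi h; exists i; rewrite hi.
case: (ex_minnP exn) => i /andP[is_ spi] imin.
pose a := take i.+1 s; pose b := drop i.+1 s.
have sa : size a = i.+1 by rewrite size_take; case: ifP; nlia.
have sb : 0 < size b by rewrite size_drop; nlia.
have sE : s = a ++ b by rewrite cat_take_drop.
have ab : allrel r a b by [].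
(* A cut of [a] would also cut [s], against the minimality of [i]. *)
have nspa : ~~ decomposable r a.
  apply/hasPn => j; rewrite mem_iota sa /= add0n => ji; apply/negP => spj.
  suff: i <= j by nlia.
  apply: imin; apply/andP; split; first by nlia.
  rewrite /cut_at sE take_cat drop_cat sa ltnS ji.
  rewrite allrel_catr; apply/andP; split => //.
  by apply/allrelP => x y /mem_take xa yb; apply: (allrelP ab).
clear imin exn spi.
have vs : v \notin s by move: us; rewrite rcons_uniq => /andP[].
have uas : uniq s by move: us; rewrite rcons_uniq => /andP[].
clearbody a b; subst s.
case: (boolP (all (fun x => r x v) a)) => va.
  apply/orP; left; apply/decomposableP; exists a, (rcons b v); split.
  - by rewrite rcons_cat.
  - by rewrite -size_eq0 sa.
  - by case: (b).
  rewrite -cats1 allrel_catr ab /=; apply/allrelP => x y xa; rewrite inE => /eqP ->.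
  exact: (allP va).
case: (boolP (all (fun x => r v x) (a ++ b))) => vab.
  apply/orP; right; apply/decomposableP; exists (a ++ b), [:: v]; split.
  - by rewrite cats1.
  - by rewrite -size_eq0 size_cat sa.
  - by [].
  apply/allrelP => x y xa; rewrite inE => /eqP ->.
  exact: (allP vab).
(* Now some [p] in [a] is above [v] and some [q] in [s] is below [v]; this [q] lies in [a], because
   all of [b] is above [p]. *)
exfalso.
case/allPn: va => p pa npv; case/allPn: vab => q qab nvq.
have vp : r v p.
  have /tot: p != v by apply: contraNneq vs => <-; rewrite mem_cat pa.
  by rewrite (negbTE npv).
have qv : r q v.
  have /tot: q != v by apply: contraNneq vs => <-.
  by rewrite (negbTE nvq) orbF.
have qa : q \in a.
  move: qab; rewrite mem_cat => /orP[//|qb].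
  have pq := allrelP ab _ _ pa qb.
  by rewrite (tr _ _ _ pq qv) in npv.
have a1 : 1 < size a.
  case: (a) pa qa npv qv => [//|x [|//]]; rewrite !inE => /eqP -> /eqP ->.
  by move/negbTE->.
have: decomposable (above r) a.
  rewrite -[decomposable _ _]orFb -(negbTE nspa); apply: IH => //.
  - by rewrite size_cat leq_addr.
  - by move: uas; rewrite cat_uniq => /andP[].
  - by move: av; rewrite rcons_cat; apply: avoids3142_catl.
  - by move: av'; rewrite rcons_cat; apply: avoids3142_catl.
case/decomposableP=> c [d [aE c0 d0 /allrelP cd]].
(* If [p] is in [d], every letter of [c] is above [p], hence above [v]; dually for [q] and [d]. *)
have [c1 c1c vc1] : exists2 c1, c1 \in c & r v c1.
  move: pa; rewrite aE mem_cat => /orP[pc|pd]; first by exists p.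
  case: c c0 cd {aE} => [//|x c] _ cd; exists x; rewrite ?mem_head //.
  by apply: tr vp _; apply: cd; rewrite ?mem_head.
have [d1 d1d d1v] : exists2 d1, d1 \in d & r d1 v.
  move: qa; rewrite aE mem_cat => /orP[qc|qd]; last by exists q.
  case: d d0 cd {aE} => [//|x d] _ cd; exists x; rewrite ?mem_head //.
  by apply: tr _ qv; apply: cd; rewrite ?mem_head.
case: b sb ab av {av' us vs uas IH spl is_ qab} => [//|y b] _ ab; apply/negP.
rewrite -cats1 aE -!catA.
(* As [d1], [v], [c1], [y] increase for [r], the letters [c1 d1 y v] form the pattern. *)
apply: (@occurs_avoids _ _ _ _ _ c1 d1 y v) => //; rewrite ?mem_head //.
by apply: (allrelP ab); rewrite ?mem_head // aE mem_cat c1c.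
Qed.

Lemma separable_decomposable (s : seq nat) :
  uniq s -> 1 < size s -> separable s -> decomposable ltn s || decomposable gtn s.
Proof.
have [n] := ubnP (size s); elim: n s => // n IHn s; rewrite ltnS => sn us s1.
case/lastP: s sn us s1 => [//|s v]; rewrite size_rcons => sn us s1 /andP[al ag].
have us' : uniq s by move: us; rewrite rcons_uniq => /andP[].
case: (leqP (size s) 1) => ss.
  case: s ss s1 us {sn al ag us'} => [|x [|//]] //= _ _; rewrite inE andbT => xv.
  by rewrite /decomposable /= /cut_at /allrel /=; nlia.
have sps : decomposable ltn s || decomposable gtn s.
  apply: IHn => //; apply/andP; split.
    by move: al; rewrite -cats1; apply: avoids3142_catl.
  by move: ag; rewrite -cats1; apply: avoids3142_catl.
have IH s' : size s' <= size s -> 1 < size s' -> uniq s' ->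
    avoids3142 ltn s' -> avoids3142 gtn s' -> decomposable ltn s' || decomposable gtn s'.
  by move=> h1 h2 h3 h4 h5; apply: IHn => //; [nlia | apply/andP].
case/orP: sps => sps.
  apply: (@decomposable_rcons ltn) => //; [exact: ltn_trans | by move=> x y /=; nlia].
rewrite orbC; apply: (@decomposable_rcons gtn) => //.
- by move=> x y z /= a b; apply: ltn_trans b a.
- by move=> x y /=; nlia.
by move=> s' h1 h2 h3 h4 h5; rewrite orbC; apply: IH.
Qed.

(** Every cut separates the first letter from the last, so the order of these two tells direct from
    skew. *)
Lemma decomposable_excl (s : seq nat) : decomposable ltn s -> ~~ decomposable gtn s.
Proof.
have H r : decomposable r s -> r (head 0 s) (last 0 s).
  case/decomposableP => a [b [-> a0 b0 /allrelP ab]].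
  case: a a0 ab => [//|x a] _ ab; case/lastP: b b0 ab => [//|b y] _ ab.
  rewrite last_cat last_rcons; apply: ab; rewrite ?mem_head //.
  by rewrite mem_rcons mem_head.
move=> /H a; apply/negP => /H /= b; move: a b => /=; nlia.
Qed.

(** * Factorisation at the first cut *)

(** Sorting [a] and [b] separately already sorts the concatenation, so they sort to the two segments
    of [iota 0 n]. *)
Lemma perm_iota_cat (a b : seq nat) n :
  perm_eq (a ++ b) (iota 0 n) -> allrel ltn a b ->
  perm_eq a (iota 0 (size a)) /\ perm_eq b (iota (size a) (size b)).
Proof.
move=> pab ab; have nE : n = size a + size b.
  by rewrite -size_cat (perm_size pab) size_iota.
have E : sort leq a ++ sort leq b = iota 0 (size a) ++ iota (size a) (size b).
  rewrite -[X in iota X (size b)]add0n -iotaD -nE.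
  apply: (sorted_eq leq_trans anti_leq).
  - rewrite sorted_pairwise ?pairwise_cat; last exact: leq_trans.
    rewrite -!sorted_pairwise; try exact: leq_trans.
    rewrite !(sort_sorted leq_total) !andbT.
    by apply/allrelP => x y; rewrite !mem_sort => xa yb; apply/ltnW/(allrelP ab).
  - exact: iota_sorted.
  by apply: perm_trans pab; apply: perm_cat; rewrite perm_sort.
move/eqP: E; rewrite eqseq_cat ?size_sort ?size_iota // => /andP[/eqP <- /eqP <-].
by rewrite !(perm_sym _ (sort _ _)) !perm_sort.
Qed.

Definition first_cut (s : seq nat) : nat :=
  find (cut_at ltn s) (iota 0 (size s).-1).

Lemma first_cut_cat (a b : seq nat) i :
  size a = i.+1 -> b != [::] -> allrel ltn a b -> ~~ decomposable ltn a ->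
  first_cut (a ++ b) = i.
Proof.
move=> sa b0 ab nsp.
have sb : 0 < size b by rewrite lt0n size_eq0.
have E : (size (a ++ b)).-1 = i + (size b).-1.+1 by rewrite size_cat sa; nlia.
have spl j : j < i -> cut_at ltn (a ++ b) j -> cut_at ltn a j.
  by move=> ji; rewrite /cut_at take_cat drop_cat sa ltnS ji allrel_catr => /andP[].
rewrite /first_cut E iotaD find_cat ifN.
  rewrite /= size_iota /cut_at add0n take_size_cat // drop_size_cat // ab; exact: addn0.
apply: contra nsp => /hasP[j]; rewrite mem_iota /= => ji /(spl _ ji) h.
by apply/hasP; exists j => //; rewrite mem_iota sa.
Qed.

Lemma first_cutP (s : seq nat) i : decomposable ltn s -> first_cut s = i ->
  exists a b, [/\ s = a ++ b, size a = i.+1, b != [::], allrel ltn a b & ~~ decomposable ltn a].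
Proof.
move=> sp <-; set k := first_cut s.
have kl : k < (size s).-1 by move: sp; rewrite /decomposable has_find size_iota.
have spk : cut_at ltn s k.
  by have := nth_find 0 sp; rewrite -/(first_cut s) nth_iota ?add0n.
have sa : size (take k.+1 s) = k.+1 by rewrite size_take; case: ifP; nlia.
exists (take k.+1 s), (drop k.+1 s); split => //; first by rewrite cat_take_drop.
  by rewrite -size_eq0 size_drop; nlia.
apply/hasPn => j; rewrite mem_iota sa /= add0n => jk; apply/negP => spj.
have /(before_find 0) : j < first_cut s by [].
rewrite nth_iota ?(ltn_trans jk) // add0n => /negP; apply.
rewrite /cut_at -{1 2}[s](cat_take_drop k.+1) take_cat drop_cat sa ltnS jk.
rewrite allrel_catr; apply/andP; split => //.
by apply/allrelP => x y /mem_take xa yb; apply: (allrelP spk).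
Qed.

Lemma separable_shift i (s : seq nat) : separable (map (addn i) s) = separable s.
Proof.
by rewrite /separable !(@avoids3142_map ltn ltn) ?(@avoids3142_map gtn gtn) //=
   => x y _ _ /=; rewrite ltn_add2l.
Qed.

(** The bijection behind P = (S - P) S: a cut is the first one exactly when its left block is
    indecomposable. The right block is arbitrary and is standardised by subtracting [j.+1]. *)
Lemma perm_first_cut m j : j < m.+1 ->
  perm_eq
    [seq s <- permutations (iota 0 m.+2)
       | (separable s && decomposable ltn s) && (first_cut s == j)]
    [seq a ++ map (addn j.+1) b
       | a <- [seq a <- permutations (iota 0 j.+1) | separable a && ~~ decomposable ltn a],
         b <- [seq b <- permutations (iota 0 (m.+1 - j)) | separable b]].
Proof.
move=> jm.
have szP n (s : seq nat) : perm_eq s (iota 0 n) -> size s = n.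
  by move/perm_size; rewrite size_iota.
apply: uniq_perm.
- by rewrite filter_uniq ?permutations_uniq.
- apply: allpairs_uniq; rewrite ?filter_uniq ?permutations_uniq //.
  move=> [a b] [a' b'] /allpairsPdep[x [y [+ _ [-> ->]]]] /allpairsPdep[x' [y' [+ _ [-> ->]]]] /=.
  rewrite !mem_filter !mem_permutations => /andP[_ /szP sx] /andP[_ /szP sx'].
  move=> /eqP; rewrite eqseq_cat ?sx ?sx' // => /andP[/eqP -> /eqP].
  by move/(inj_map (@addnI _)) ->.
move=> s; rewrite mem_filter mem_permutations; apply/idP/allpairsPdep.
  case/andP=> /andP[/andP[sep spl] /eqP fs] ps.
  have [a [b [sE sa b0 ab nsp]]] := first_cutP spl fs; subst s.
  have [pa pb] := perm_iota_cat ps ab.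
  have sb : size b = m.+1 - j by move: (szP _ _ ps); rewrite size_cat; nlia.
  move: sep; rewrite separable_cat // => /andP[sepa sepb].
  have bE : map (addn j.+1) (map (subn^~ j.+1) b) = b.
    rewrite -map_comp map_id_in // => x; rewrite (perm_mem pb) mem_iota sa /=.
    by move=> /andP[h _]; rewrite subnKC.
  exists a, (map (subn^~ j.+1) b); split; last by rewrite bE.
    by rewrite mem_filter sepa nsp mem_permutations -sa.
  rewrite mem_filter mem_permutations -sb -(separable_shift j.+1) bE sepb /=.
  rewrite -sa; apply: (perm_trans (perm_map _ pb)).
  by rewrite -[X in iota X (size b)]addn0 iotaDl -map_comp map_id_in // => x _ /=; rewrite addKn.
case=> a [b []]; rewrite !mem_filter !mem_permutations.
move=> /andP[/andP[sepa nsp] pa] /andP[sepb pb] ->.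
have sa := szP _ _ pa; have sb := szP _ _ pb.
have ab : allrel ltn a (map (addn j.+1) b).
  apply/allrelP => x _ xa /mapP[y _ ->]; move: xa; rewrite (perm_mem pa) mem_iota /=; nlia.
have b0 : map (addn j.+1) b != [::] by rewrite -size_eq0 size_map; nlia.
rewrite separable_cat // separable_shift sepa sepb !andTb; apply/andP; split.
  apply/andP; split; last by rewrite (first_cut_cat sa).
  apply/decomposableP; exists a, (map (addn j.+1) b); split => //.
  by rewrite -size_eq0 sa.
have -> : m.+2 = j.+1 + (m.+1 - j) by lia.
rewrite iotaD add0n; apply: perm_cat => //.
by rewrite -[X in iota X _]addn0 iotaDl perm_map.
Qed.

(** * Recurrences for weighted sums over separable permutations *)

Local Open Scope ring_scope.

Section WeightedSums.
Variables (R : comNzRingType) (f : seq nat -> R) (c : R).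

Definition sep_sum n : R := \sum_(s <- permutations (iota 0 n) | separable s) f s.

Definition dec_sum n : R :=
  \sum_(s <- permutations (iota 0 n) | separable s && decomposable ltn s) f s.

Hypothesis f_shift : forall i s, f (map (addn i) s) = f s.
Hypothesis f_cat : forall s t : seq nat, s != [::] -> t != [::] -> allrel ltn s t ->
  f (s ++ t) = c * f s * f t.

(** [c] is the weight of the step across the cut: 1 when descents are counted, ['X] when ascents
    are. The difference counts the indecomposable left blocks. *)
Lemma dec_sum_rec m :
  dec_sum m.+2 =
  c * \sum_(j < m.+1) (sep_sum j.+1 - dec_sum j.+1) * sep_sum (m.+1 - j).
Proof.
(* The first cut of a decomposable word of size [m.+2] is below [m.+1], so [inord] never takes its
   default value there. *)
rewrite /dec_sum (partition_big (fun s => inord (first_cut s) : 'I_m.+1) predT) //=.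
rewrite big_distrr /=; apply: eq_bigr => j _.
have -> : sep_sum j.+1 - dec_sum j.+1
    = \sum_(a <- permutations (iota 0 j.+1) | separable a && ~~ decomposable ltn a) f a.
  by rewrite /sep_sum (bigID (decomposable ltn)) /= /dec_sum addrC addrK.
transitivity (\sum_(s <- permutations (iota 0 m.+2)
     | (separable s && decomposable ltn s) && (first_cut s == j)) f s).
  rewrite big_seq_cond [RHS]big_seq_cond; apply: eq_bigl => s.
  rewrite mem_permutations; case ps: perm_eq => //=.
  case: (boolP (decomposable ltn s)); rewrite ?andbF ?andbT //= => spl; congr andb.
  have h : (first_cut s < m.+1)%N.
    move: spl; rewrite /decomposable has_find size_iota => /leq_trans -> //.
    by rewrite (perm_size ps) /= size_iota.
  by rewrite -val_eqE /= inordK.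
rewrite -big_filter (perm_big _ (perm_first_cut (ltn_ord j))) /=.
rewrite big_allpairs_dep big_filter mulr_suml mulr_sumr.
rewrite big_seq_cond [RHS]big_seq_cond; apply: eq_bigr => a.
rewrite mem_permutations => /andP[pa _].
rewrite big_filter /sep_sum mulrA mulr_sumr big_seq_cond [RHS]big_seq_cond.
apply: eq_bigr => b; rewrite mem_permutations => /andP[pb _].
rewrite f_cat ?f_shift //.
- by rewrite -size_eq0 (perm_size pa).
- by rewrite -size_eq0 size_map (perm_size pb) size_iota; have := ltn_ord j; nlia.
apply/allrelP => x _ xa /mapP[y _ ->].
by move: xa; rewrite (perm_mem pa) -[0%N :: _]/(iota 0 j.+1) mem_iota /=; nlia.
Qed.
End WeightedSums.

(* Complementation exchanges direct and skew decompositions, ascents and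
   descents; this reduces skew-decomposable permutations to [dec_sum]. *)
Lemma perm_permutations_compl n :
  perm_eq (permutations (iota 0 n)) [seq map (subn n.-1) s | s <- permutations (iota 0 n)].
Proof.
have inj : {in permutations (iota 0 n) &, injective (map (subn n.-1))}.
  move=> s t; rewrite !mem_permutations => ps pt E.
  have H u : perm_eq u (iota 0 n) -> map (subn n.-1) (map (subn n.-1) u) = u.
    move=> pu; rewrite -map_comp map_id_in // => x.
    by rewrite (perm_mem pu) mem_iota /=; nlia.
  by rewrite -(H s) // E H.
have us : uniq [seq map (subn n.-1) s | s <- permutations (iota 0 n)].
  by rewrite map_inj_in_uniq ?permutations_uniq.
suff sub : {subset [seq map (subn n.-1) s | s <- permutations (iota 0 n)]
             <= permutations (iota 0 n)}.
  rewrite perm_sym; apply: uniq_perm; rewrite ?permutations_uniq //.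
  by have [] := uniq_min_size us sub; rewrite ?size_map.
move=> _ /mapP[s + ->].
rewrite !mem_permutations => ps; apply: uniq_perm; rewrite ?iota_uniq //.
  rewrite map_inj_in_uniq ?(perm_uniq ps) ?iota_uniq // => x y.
  by rewrite !(perm_mem ps) !mem_iota /=; nlia.
move=> x; rewrite mem_iota /=; apply/mapP/idP.
  by case=> y; rewrite (perm_mem ps) mem_iota /= => h ->; nlia.
by move=> h; exists (n.-1 - x)%N; rewrite ?(perm_mem ps) ?mem_iota; nlia.
Qed.

(** The flag gives two uses: false yields the equidistribution of ascents and descents, true turns
    skew decompositions into direct ones. *)
Lemma sum_compl (R : comNzRingType) (F : nat -> R) (b : bool) n :
  \sum_(s <- permutations (iota 0 n) | separable s && (b ==> decomposable gtn s))
     F (steps gtn s)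
  = \sum_(s <- permutations (iota 0 n) | separable s && (b ==> decomposable ltn s))
     F (steps ltn s).
Proof.
rewrite (perm_big _ (perm_permutations_compl n)) /= big_map.
have H r r' s : s \in permutations (iota 0 n) ->
    (forall x y, r' x y = r y x) -> r = ltn \/ r = gtn ->
    {in s &, forall x y, r' (n.-1 - x)%N (n.-1 - y)%N = r x y}.
  rewrite mem_permutations => ps E rE x y; rewrite !(perm_mem ps) !mem_iota /= E.
  by case: rE => -> /=; nlia.
rewrite big_seq_cond [RHS]big_seq_cond.
have E s : s \in permutations (iota 0 n) ->
   [/\ separable (map (subn n.-1) s) = separable s,
    decomposable gtn (map (subn n.-1) s) = decomposable ltn s &
    steps gtn (map (subn n.-1) s) = steps ltn s].
  move=> sp; have hl := H ltn gtn s sp (fun _ _ => erefl) (or_introl erefl).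
  have hg := H gtn ltn s sp (fun _ _ => erefl) (or_intror erefl).
  rewrite /separable (avoids3142_map hl) (avoids3142_map hg) (decomposable_map hl).
  by rewrite (steps_map hl) andbC.
apply: congr_big => // s.
  by case sp : (s \in _); rewrite //= ; have [-> -> _] := E s sp.
by case/andP=> /E[_ _ ->].
Qed.

Definition des_weight (s : seq nat) : {poly int} := 'X ^+ steps gtn s.
Definition asc_weight (s : seq nat) : {poly int} := 'X ^+ steps ltn s.

Lemma sep_sum_asc n : sep_sum asc_weight n = sep_sum des_weight n.
Proof.
have := sum_compl (fun k => 'X ^+ k : {poly int}) false n.
by under eq_bigl do rewrite andbT; under [in RHS]eq_bigl do rewrite andbT.
Qed.

(** From size two on, exactly one kind of cut exists. Complementation counts the skew-decomposable
    permutations by the ascents of direct ones, so [dec_sum asc_weight] gives the coefficients of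
    M. *)
Lemma sep_sum_split m :
  sep_sum des_weight m.+2 = dec_sum des_weight m.+2 + dec_sum asc_weight m.+2.
Proof.
rewrite /sep_sum (bigID (decomposable ltn)) /=; congr (_ + _).
rewrite -[RHS](sum_compl (fun k => 'X ^+ k : {poly int}) true) /=.
rewrite big_seq_cond [RHS]big_seq_cond; apply: eq_bigl => s.
rewrite mem_permutations; case ps: perm_eq => //=; case sp: separable => //=.
have := @decomposable_excl s.
have := @separable_decomposable s; rewrite sp (perm_uniq ps) (perm_size ps).
rewrite (iota_uniq 0 m.+2) => /(_ isT isT isT).
by case: (decomposable gtn s); case: (decomposable ltn s) => //= _ /(_ isT).
Qed.

Lemma steps_shift (r : rel nat) i s :
  (forall x y, r (i + x)%N (i + y)%N = r x y) -> steps r (map (addn i) s) = steps r s.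
Proof. by move=> E; apply: steps_map => x y _ _; apply: E. Qed.

Lemma steps_cat_dec (r : rel nat) (b : bool) (s t : seq nat) :
  s != [::] -> t != [::] -> allrel ltn s t -> (forall x y, x < y -> r x y = b)%N ->
  steps r (s ++ t) = (b + steps r s + steps r t)%N.
Proof.
case: s => [//|x s]; case: t => [//|y t] _ _ st rb; rewrite steps_cat.
rewrite rb 1?[X in (X + _)%N]addnC //.
by apply: (allrelP st); rewrite ?mem_last ?mem_head.
Qed.

Lemma dec_sum_des m :
  dec_sum des_weight m.+2 =
  \sum_(j < m.+1) (sep_sum des_weight j.+1 - dec_sum des_weight j.+1)
                  * sep_sum des_weight (m.+1 - j).
Proof.
rewrite (@dec_sum_rec _ des_weight 1) ?mul1r //.
  by move=> i s; rewrite /des_weight steps_shift // => x y /=; rewrite ltn_add2l.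
move=> s t s0 t0 st; rewrite /des_weight mul1r (@steps_cat_dec gtn false) ?exprD //.
by move=> x y /=; nlia.
Qed.

Lemma dec_sum_asc m :
  dec_sum asc_weight m.+2 =
  'X * \sum_(j < m.+1) (sep_sum des_weight j.+1 - dec_sum asc_weight j.+1)
                  * sep_sum des_weight (m.+1 - j).
Proof.
rewrite (@dec_sum_rec _ asc_weight 'X).
- by under eq_bigr do rewrite !sep_sum_asc.
- by move=> i s; rewrite /asc_weight steps_shift // => x y /=; rewrite ltn_add2l.
move=> s t s0 t0 st; rewrite /asc_weight (@steps_cat_dec ltn true) ?exprD //.
Qed.

Local Close Scope ring_scope.

(** * Permutations as words *)

Definition word n (s : 'S_n) : seq nat := [seq val (s i) | i <- enum 'I_n].

Lemma size_word n (s : 'S_n) : size (word s) = n.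
Proof. by rewrite size_map size_enum_ord. Qed.

Lemma nth_word n (s : 'S_n) (i : 'I_n) : nth 0 (word s) i = s i.
Proof. by rewrite (nth_map i) ?size_enum_ord // nth_ord_enum. Qed.

(* The hypothesis says that the [r]-conditions of [occurs3142] express that the
   values [v 0, ..., v 3] are order-isomorphic to the pattern. *)
Lemma contains_word n (s : 'S_n) (r : rel nat) (p0 p1 p2 p3 : nat) :
  (forall v : nat -> nat,
     [&& r (v 1) (v 3), r (v 3) (v 0) & r (v 0) (v 2)] <->
     forall a b, a < 4 -> b < 4 ->
       (v a < v b) = (nth 0 [:: p0; p1; p2; p3] a < nth 0 [:: p0; p1; p2; p3] b)) ->
  contains s [:: p0; p1; p2; p3] = ~~ avoids3142 r (word s).
Proof.
move=> rP; rewrite /contains /=; apply/existsP/idP.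
  case=> f /forallP fP; apply/avoids3142P.
  pose o k (h : k < 4) := f (Ordinal h).
  move=> /(_ (o 0 isT) (o 1 isT) (o 2 isT) (o 3 isT)) /negP; apply.
  have inc k l (hk : k < 4) (hl : l < 4) : k < l -> o k hk < o l hl.
    by move=> kl; have /forallP/(_ (Ordinal hl))/andP[/implyP + _] := fP (Ordinal hk); apply.
  rewrite /occurs3142 !inc // size_word ltn_ord /= !nth_word.
  pose v k : nat := if insub k is Some a then s (f a) else 0.
  have vE k (h : k < 4) : s (o k h) = v k :> nat by rewrite /v insubT.
  rewrite !vE; apply/rP => a b ha hb; rewrite -!vE.
  by have /forallP/(_ (Ordinal hb))/andP[_ /eqP] := fP (Ordinal ha).
rewrite negbK => /existsP[i /existsP[j /existsP[k /existsP[l]]]].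
case/and5P=> ij jk kl lst h.
have sz := size_word s.
pose c (x : 'I_(size (word s))) := cast_ord sz x.
have cE (x : 'I_(size (word s))) : nth 0 (word s) x = s (c x) by rewrite -nth_word.
pose f : {ffun 'I_4 -> 'I_n} := [ffun a : 'I_4 => nth (c i) [:: c i; c j; c k; c l] a].
exists f; apply/forallP => a; apply/forallP => b; apply/andP; split.
  apply/implyP; rewrite !ffunE.
  by case: a => [[|[|[|[|//]]]] ?]; case: b => [[|[|[|[|//]]]] ?] //= _; nlia.
apply/eqP; rewrite !ffunE.
pose v m : nat := s (nth (c i) [:: c i; c j; c k; c l] m).
move: h; rewrite !cE => h.
by have /(_ a b (ltn_ord a) (ltn_ord b)) := (rP v).1 h.
Qed.

Lemma separable_word n (s : 'S_n) : avoids_2413_3142 s = separable (word s).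
Proof.
rewrite /avoids_2413_3142 /separable.
rewrite (@contains_word _ s gtn) ?(@contains_word _ s ltn) ?negbK 1?andbC //.
  move=> v /=; split => [h [|[|[|[|//]]]] [|[|[|[|//]]]] _ _ /=|h]; try lia.
  by have := h 1 3 isT isT; have := h 3 0 isT isT; have := h 0 2 isT isT; rewrite /=; lia.
move=> v /=; split => [h [|[|[|[|//]]]] [|[|[|[|//]]]] _ _ /=|h]; try lia.
by have := h 3 1 isT isT; have := h 0 3 isT isT; have := h 2 0 isT isT; rewrite /=; lia.
Qed.

Lemma stepsE (r : rel nat) (s : seq nat) :
  steps r s = \sum_(i < (size s).-1) r (nth 0 s i) (nth 0 s i.+1).
Proof.
case: s => [|x s]; first by rewrite big_ord0.
rewrite /steps /=; elim: s x => [|y s IH] x /=; first by rewrite big_ord0.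
by rewrite big_ord_recl IH /=.
Qed.

Lemma des_word n (s : 'S_n) : des s = steps gtn (word s).
Proof.
rewrite stepsE size_word /des -sum1_card.
case: n s => [|n] s; first by rewrite big_ord0 big_pred0 // => -[].
(* The last position has no successor, so it is never a descent. *)
rewrite big_mkcond big_ord_recr /= inE [X in _ + X]ifF; last first.
  by apply/negbTE/existsP => -[j /andP[/eqP jn _]]; have := ltn_ord j; rewrite jn ltnn.
rewrite addn0; apply: eq_bigr => i _.
have -> : nth 0 (word s) i.+1 = s (lift ord0 i) by rewrite -nth_word.
have -> : nth 0 (word s) i = s (widen_ord (leqnSn n) i) by rewrite -nth_word.
rewrite inE -[LHS]/(nat_of_bool _); congr nat_of_bool; apply/existsP/idP => [[j /andP[/eqP jE]]|h].
  by have -> : j = lift ord0 i by apply/val_inj.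
by exists (lift ord0 i); rewrite h eqxx.
Qed.

(** [word] is injective and both lists have n! entries, so inclusion suffices. *)
Lemma perm_word n : perm_eq [seq word s | s <- index_enum 'S_n] (permutations (iota 0 n)).
Proof.
have inj : injective (@word n).
  by move=> s t E; apply/permP => i; apply: val_inj; rewrite /= -!nth_word E.
have us : uniq [seq word s | s <- index_enum 'S_n].
  by rewrite map_inj_uniq ?index_enum_uniq.
suff sub : {subset [seq word s | s <- index_enum 'S_n] <= permutations (iota 0 n)}.
  apply: uniq_perm; rewrite ?permutations_uniq //.
  have [] // := uniq_min_size us sub.
  rewrite size_map size_permutations ?iota_uniq // size_iota -card_Sn cardT.
  by rewrite enumT.
move=> _ /mapP[s _ ->]; rewrite mem_permutations; apply: uniq_perm.
- by rewrite map_inj_uniq ?enum_uniq // => i j /val_inj/perm_inj.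
- exact: iota_uniq.
move=> x; rewrite mem_iota /=; apply/mapP/idP => [[i _ ->]|xn]; first exact: ltn_ord.
by exists ((s^-1)%g (Ordinal xn)); rewrite ?mem_enum ?permKV.
Qed.

Lemma des_poly_sep_sum n : des_poly n = sep_sum des_weight n.
Proof.
rewrite /des_poly /sep_sum -(perm_big _ (perm_word n)) /= big_map.
apply: eq_big => s; first exact: separable_word.
by rewrite /des_weight des_word.
Qed.

(** * Enumeration of binary trees by size *)

Local Open Scope ring_scope.

(* [h] is fuel: [trees_upto h m] lists the trees with [m] nodes when [m <= h]. *)
Fixpoint trees_upto (h m : nat) {struct h} : seq btree :=
  match h, m with
  | _, 0%N => [:: Leaf]
  | 0%N, _ => [::]
  | h'.+1, m'.+1 =>
      [seq Node p.1 p.2 | p <- flatten [seq [seq (l, r) | l <- trees_upto h' i,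
         r <- trees_upto h' (m' - i)] | i <- iota 0 m'.+1]]
  end.

Definition trees (m : nat) : seq btree := trees_upto m m.

Lemma trees_uptoS h m :
  trees_upto h.+1 m.+1 =
  [seq Node p.1 p.2 | p <- flatten [seq [seq (l, r) | l <- trees_upto h i,
     r <- trees_upto h (m - i)] | i <- iota 0 m.+1]].
Proof. by []. Qed.

Lemma mem_trees_upto h m t : (m <= h)%N -> (t \in trees_upto h m) = (nnodes t == m).
Proof.
elim: h m t => [|h IH] [|m] t // mh; try by case: t => [|l r]; rewrite ?inE.
case: t => [|l r].
  by rewrite [RHS]/=; apply/negbTE/mapP => -[].
rewrite [nnodes _]/= eqSS.
rewrite trees_uptoS; apply/mapP/eqP.
  case=> -[l' r'] /flattenP[_ /mapP[i + ->]] /allpairsPdep[x [y [+ + [-> ->]]]] [-> ->].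
  by rewrite mem_iota => /= im; rewrite !IH ?(leq_trans (leq_subr _ _)) //; lia.
move=> E; exists (l, r) => //; apply/flattenP.
exists [seq (a, b) | a <- trees_upto h (nnodes l), b <- trees_upto h (m - nnodes l)].
  by apply/mapP; exists (nnodes l) => //; rewrite mem_iota; lia.
by apply/allpairsPdep; exists l, r; rewrite !IH; [split=> //; lia | lia | lia].
Qed.

Lemma uniq_trees_upto h m : (m <= h)%N -> uniq (trees_upto h m).
Proof.
elim: h m => [|h IH] [|m] // mh.
rewrite trees_uptoS map_inj_uniq; last by move=> [a b] [c d] /= [-> ->].
have : all (fun i => i <= m)%N (iota 0 m.+1).
  by apply/allP => i; rewrite mem_iota.
elim: (iota 0 m.+1) (iota_uniq 0 m.+1) => [//|i s IHs] /= /andP[is_ us] /andP[im sm].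
rewrite cat_uniq {}IHs // andbT; apply/andP; split.
  by apply: allpairs_uniq; [apply: IH; lia | apply: IH; lia | move=> [a b] [c d]].
(* The lists for distinct sizes are disjoint, as the left subtree determines the size. *)
apply/hasPn => -[l r] /flattenP[_ /mapP[j js ->]] /allpairsPdep[x [y [xj _ [-> ->]]]].
apply/negP => /allpairsPdep[x' [y' [xi _ [E _]]]]; subst x'.
move: xj xi; rewrite !mem_trees_upto; try by [lia | have := allP sm _ js; lia].
by move=> /eqP xj /eqP xi; move: is_; rewrite -xi xj js.
Qed.

Lemma mem_trees m t : (t \in trees m) = (nnodes t == m).
Proof. exact: mem_trees_upto. Qed.

Lemma perm_trees m ts :
  uniq ts -> (forall t, (t \in ts) = (nnodes t == m)) -> perm_eq ts (trees m).
Proof.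
by move=> u h; apply: uniq_perm; rewrite ?uniq_trees_upto // => t; rewrite h mem_trees.
Qed.

Lemma sum_treesS (R : nmodType) (F : btree -> R) m :
  \sum_(t <- trees m.+1) F t =
  \sum_(i < m.+1) \sum_(l <- trees i) \sum_(r <- trees (m - i)) F (Node l r).
Proof.
have H i : (i <= m)%N -> perm_eq (trees_upto m i) (trees i).
  by move=> im; apply: perm_trees; rewrite ?uniq_trees_upto // => t; rewrite mem_trees_upto.
rewrite {1}/trees trees_uptoS big_map big_flatten big_map.
rewrite -{1}(subn0 m.+1) -/(index_iota 0 m.+1) big_mkord; apply: eq_bigr => i _.
rewrite big_allpairs_dep /= (perm_big _ (H _ _)) /=; last by rewrite -ltnS.
by apply: eq_bigr => l _; rewrite (perm_big _ (H _ _)) //= leq_subr.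
Qed.

(** * Weights of right chains *)

Definition chain_weight (l : nat) : {poly int} :=
  (if odd l then 1 + 'X else 2%:R) * 'X ^+ l./2.

Definition tree_weight (head : bool) (t : btree) : {poly int} :=
  \prod_(l <- chains_in head t) chain_weight l.

(** Halving loses one unit per odd length. For the chains of a tree with n-1 nodes and r_o = n-1-2k,
    this is the summand 2^(r_e) t^k (1+t)^(n-1-2k). *)
Lemma prod_chain_weight (s : seq nat) :
  \prod_(l <- s) chain_weight l =
  (2 ^ count (fun l => ~~ odd l) s)%:R * 'X ^+ (sumn s - count odd s)./2
    * (1 + 'X) ^+ count odd s.
Proof.
have Ele u : (count odd u <= sumn u)%N.
  by elim: u => //= l u IH; case ol: (odd l) => /=; lia.
elim: s => [|l s IH]; first by rewrite big_nil !mul1r.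
rewrite big_cons IH /= /chain_weight; have := Ele s; have lE := odd_double_half l.
case: (odd l) lE => /= lE ls.
  have -> : (l + sumn s - (1 + count odd s) = l./2.*2 + (sumn s - count odd s))%N by lia.
  by rewrite halfD odd_double /= doubleK !add0n add1n exprS exprD; ring.
have -> : (l + sumn s - (0 + count odd s) = l./2.*2 + (sumn s - count odd s))%N by lia.
rewrite halfD odd_double /= doubleK !add0n exprD add1n expnS natrM; ring.
Qed.

Lemma sumn_chains_in t :
  sumn (chains_in true t) = nnodes t /\
  (sumn (chains_in false t) + spine t)%N = nnodes t.
Proof. by elim: t => [//|l [IHl _] r [_ IHr]] /=; rewrite sumn_cat; lia. Qed.

(** The parity factor of the root chain is withheld, since a new root above it changes the parity.
    The empty tree is even with value 1, whence the -1 in T = (1 + t) O + 2 E - 1. *)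
Definition even_part (t : btree) : {poly int} :=
  if odd (spine t) then 0 else 'X ^+ (spine t)./2 * tree_weight false t.
Definition odd_part (t : btree) : {poly int} :=
  if odd (spine t) then 'X ^+ (spine t)./2 * tree_weight false t else 0.

Lemma tree_weight_false_Node l r :
  tree_weight false (Node l r) = tree_weight true l * tree_weight false r.
Proof. by rewrite /tree_weight /= big_cat. Qed.

Lemma tree_weight_true_Node l r :
  tree_weight true (Node l r) =
  (1 + 'X) * odd_part (Node l r) + 2%:R * even_part (Node l r).
Proof.
rewrite {1}/tree_weight /= big_cons -/(tree_weight false (Node l r)).
rewrite /odd_part /even_part /chain_weight [spine _]/=; case: ifP => _; ring.
Qed.

(** A new root leaves the rounded half length of an even chain unchanged and raises that of an odd
    chain by one, which gives the ['X] in [even_part_Node]. *)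
Lemma odd_part_Node l r : odd_part (Node l r) = tree_weight true l * even_part r.
Proof.
rewrite /odd_part /even_part tree_weight_false_Node /= uphalf_half.
by case: (odd (spine r)) => /=; rewrite ?mulr0 // mulrCA.
Qed.

Lemma even_part_Node l r : even_part (Node l r) = 'X * (tree_weight true l * odd_part r).
Proof.
rewrite /odd_part /even_part tree_weight_false_Node /= uphalf_half.
by case: (odd (spine r)) => /=; rewrite ?mulr0 // add1n exprS; ring.
Qed.

Definition tree_sum (m : nat) : {poly int} := \sum_(t <- trees m) tree_weight true t.
Definition even_sum (m : nat) : {poly int} := \sum_(t <- trees m) even_part t.
Definition odd_sum (m : nat) : {poly int} := \sum_(t <- trees m) odd_part t.

Lemma tree_sum0 : tree_sum 0 = 1.
Proof. by rewrite /tree_sum big_seq1 /tree_weight big_nil. Qed.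

Lemma even_sum0 : even_sum 0 = 1.
Proof. by rewrite /even_sum big_seq1 /even_part /= /tree_weight big_nil mulr1. Qed.

Lemma odd_sum0 : odd_sum 0 = 0.
Proof. by rewrite /odd_sum big_seq1. Qed.

Lemma tree_sumS m : tree_sum m.+1 = (1 + 'X) * odd_sum m.+1 + 2%:R * even_sum m.+1.
Proof.
rewrite /tree_sum /odd_sum /even_sum !mulr_sumr -big_split big_seq [RHS]big_seq.
by apply: eq_bigr => -[|l r]; rewrite mem_trees // tree_weight_true_Node.
Qed.

Lemma odd_sumS m : odd_sum m.+1 = \sum_(i < m.+1) tree_sum i * even_sum (m - i).
Proof.
rewrite /odd_sum sum_treesS; apply: eq_bigr => i _; rewrite mulr_suml.
by apply: eq_bigr => l _; rewrite mulr_sumr; apply: eq_bigr => r _; rewrite odd_part_Node.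
Qed.

Lemma even_sumS m : even_sum m.+1 = 'X * \sum_(i < m.+1) tree_sum i * odd_sum (m - i).
Proof.
rewrite /even_sum sum_treesS mulr_sumr; apply: eq_bigr => i _; rewrite mulr_suml mulr_sumr.
by apply: eq_bigr => l _; rewrite !mulr_sumr; apply: eq_bigr => r _; rewrite even_part_Node.
Qed.

Lemma gamma_expansion_trees n (ts : seq btree) :
  (0 < n)%N -> uniq ts -> (forall t, (t \in ts) = (nnodes t == n.-1)) ->
  gamma_expansion n (fun k => Posz (gammaT n ts k)) = tree_sum n.-1.
Proof.
move=> n0 uts mts; rewrite /tree_sum -(perm_big _ (perm_trees uts mts)) /=.
rewrite /gamma_expansion /gammaT.
transitivity (\sum_(k < (n.-1)./2.+1) \sum_(t <- ts | r_o t == (n.-1 - k.*2)%N)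
   (2 ^ r_e t)%:R * 'X ^+ k * (1 + 'X) ^+ (n.-1 - k.*2) : {poly int}).
  apply: eq_bigr => k _; rewrite -!mulr_suml; congr (_ * _ * _).
  by rewrite -natz natr_sum rmorph_sum /=; apply: eq_bigr => t _; rewrite rmorph_nat.
rewrite (exchange_big_dep predT) //= big_seq [RHS]big_seq; apply: eq_bigr => t.
rewrite mts => /eqP nt; rewrite /tree_weight prod_chain_weight.
have [sE _] := sumn_chains_in t; rewrite sE nt.
rewrite -/(right_chains t) -/(r_o t) -/(r_e t).
(* Each length is its parity plus an even number, so [r_o t] and the number of nodes agree in parity
   and each tree is counted for exactly one [k]. *)
have [k kE] : exists k, n.-1 = (r_o t + k.*2)%N.
  rewrite -nt -sE /r_o /right_chains; elim: (chains_in _ _) => [|l s [k IH]] /=.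
    by exists 0%N.
  exists (l./2 + k)%N; rewrite IH doubleD; have := odd_double_half l; lia.
have kn : (k < (n.-1)./2.+1)%N by lia.
rewrite (big_pred1 (Ordinal kn)) => [|i].
  have -> : (n.-1 - (Ordinal kn).*2 = r_o t)%N by rewrite /=; lia.
  by have -> : (n.-1 - r_o t)./2 = k by lia.
by rewrite /= -(inj_eq val_inj) /=; have := ltn_ord i; lia.
Qed.

(** * Congruences modulo a power of x *)

Section Truncated.
Variables (R : comNzRingType) (N : nat).
Implicit Types p q u v : {poly R}.

(** The explicit quotient lets congruences be combined by giving a new quotient and calling
    [ring]. *)
Definition eqpX p q : Prop := exists r, p = q + r * 'X^N.

Lemma eqpX_coef p q : (forall i, (i < N)%N -> p`_i = q`_i) -> eqpX p q.
Proof.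
move=> H; exists (drop_poly N (p - q)); apply/eqP; rewrite -subr_eq0 opprD addrA subr_eq0.
apply/eqP; rewrite -[LHS](poly_take_drop N); rewrite [take_poly _ _](_ : _ = 0) ?add0r //.
apply/polyP => i; rewrite coef_take_poly coef0; case: ifP => // iN.
by rewrite coefB H // subrr.
Qed.

Lemma coef_eqpX p q i : eqpX p q -> (i < N)%N -> p`_i = q`_i.
Proof. by case=> r -> iN; rewrite coefD coefMXn iN addr0. Qed.

(** Coefficient [i] of the right side involves only coefficients of [D] below [i], so they vanish
    one after another. *)
Lemma eqpX_contract (K D : {poly R}) : eqpX D ('X * K * D) -> eqpX D 0.
Proof.
move=> H; apply: eqpX_coef => i; rewrite coef0.
elim/ltn_ind: i => -[|i] IH iN.
  by rewrite (coef_eqpX H iN) -mulrA coefXM.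
rewrite (coef_eqpX H iN) -mulrA coefXM /= coefM big1 // => j _.
by rewrite IH ?mulr0 //; lia.
Qed.

Definition gf (a : nat -> R) : {poly R} := \poly_(i < N) a i.

Lemma coef_gf a i : (i < N)%N -> (gf a)`_i = a i.
Proof. by rewrite coef_poly => ->. Qed.

Lemma coef_gfM a b i : (i < N)%N -> (gf a * gf b)`_i = \sum_(j < i.+1) a j * b (i - j)%N.
Proof.
move=> iN; rewrite coefM; apply: eq_bigr => j _.
by rewrite !coef_gf //; have := ltn_ord j; lia.
Qed.

(* The difference of two solutions is a multiple of itself by a series without
   constant term. *)
Lemma eqpX_unique (t : R) (p q : {poly R}) :
  let F s := 'X * (1 + 'X * s) * (1 + t%:P * ('X * s)) in
  eqpX ((1 - t%:P * ('X * p) ^+ 2) * ('X * p)) (F p) ->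
  eqpX ((1 - t%:P * ('X * q) ^+ 2) * ('X * q)) (F q) ->
  eqpX ('X * p) ('X * q).
Proof.
move=> F [r pE] [s qE].
suff [u uE] : eqpX ('X * p - 'X * q) 0.
  by exists u; rewrite -[LHS](subrK ('X * q)) uE add0r addrC.
(* Moving the cubic term to the right and subtracting the two equations, every term contains
   ['X * p - 'X * q] and a further ['X]; the cofactor is [K]. *)
pose K := 1 + t%:P + t%:P * ('X * p + 'X * q) + t%:P * 'X * (p ^+ 2 + p * q + q ^+ 2).
apply: (@eqpX_contract K); exists (r - s).
have -> : (r - s) * 'X^N = (F p + r * 'X^N) - (F q + s * 'X^N) - F p + F q by ring.
rewrite -pE -qE /F /K; ring.
Qed.
End Truncated.

(** * The common functional equation *)

(** The empty permutation is dropped: it would add 1 to the constant term of S. *)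
Definition perm_coef (m : nat) : {poly int} := if m is 0%N then 0 else sep_sum des_weight m.

Lemma dec_sum_small (f : seq nat -> {poly int}) m : (m < 2)%N -> dec_sum f m = 0.
Proof.
move=> m2; rewrite /dec_sum big_seq_cond big_pred0 // => s; rewrite mem_permutations.
apply/negbTE; apply: contraL m2 => /and3P[ps _ +].
by rewrite /decomposable has_find size_iota (perm_size ps) size_iota; lia.
Qed.

Lemma sep_sum1 : sep_sum des_weight 1 = 1.
Proof.
rewrite /sep_sum -[permutations _]/[:: [:: 0%N]] big_cons big_nil addr0.
rewrite ifT //; apply/andP; split; apply/avoids3142P => i j k l.
  by apply/negP => /and5P[ij jk kl /= l1 _]; lia.
by apply/negP => /and5P[ij jk kl /= l1 _]; lia.
Qed.

(** The recurrence becomes a full Cauchy product, whose two extreme terms vanish because [perm_coef]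
    and [dec_sum] are zero at 0. *)
Lemma dec_sum_conv (f : seq nat -> {poly int}) (c : {poly int}) i :
  (forall m, dec_sum f m.+2 = c * \sum_(j < m.+1)
      (sep_sum des_weight j.+1 - dec_sum f j.+1) * sep_sum des_weight (m.+1 - j)) ->
  dec_sum f i = c * \sum_(j < i.+1) (perm_coef j - dec_sum f j) * perm_coef (i - j).
Proof.
move=> rec; case: i => [|[|m]].
- by rewrite big_ord1 !dec_sum_small // mulr0 mulr0.
- rewrite dec_sum_small // big_ord_recl big_ord1 subnn mulr0 addr0.
  by rewrite [dec_sum _ _]dec_sum_small // subrr mul0r mulr0.
rewrite rec [in RHS]big_ord_recl [in RHS]big_ord_recr /= [dec_sum f 0]dec_sum_small //.
rewrite subrr mul0r add0r /bump /= subnn mulr0 addr0; congr (_ * _); apply: eq_bigr => j _.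
by rewrite /bump /= add1n subSS subSn // -ltnS.
Qed.

Lemma gf_perm N :
  let S := gf N perm_coef in
  eqpX N ((1 - 'X%:P * S ^+ 2) * S) ('X * (1 + S) * (1 + 'X%:P * S)).
Proof.
move=> S; pose P := gf N (dec_sum des_weight); pose M := gf N (dec_sum asc_weight).
have gfB a b : gf N a - gf N b = gf N (fun i => a i - b i) :> {poly {poly int}}.
  by apply/polyP => i; rewrite coefB !coef_poly; case: ifP => //; rewrite subrr.
have [r rE] : eqpX N P ((S - P) * S).
  apply: eqpX_coef => i iN; rewrite gfB coef_gf // coef_gfM //.
  by rewrite (@dec_sum_conv _ 1) ?mul1r // => m; rewrite mul1r dec_sum_des.
have [s sE] : eqpX N M ('X%:P * ((S - M) * S)).
  apply: eqpX_coef => i iN; rewrite gfB coef_gf // coefCM coef_gfM //.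
  by rewrite (@dec_sum_conv _ 'X) // => m; rewrite dec_sum_asc.
have [u uE] : eqpX N S ('X + P + M).
  apply: eqpX_coef => i iN; rewrite !coefD !coef_gf // coefX.
  case: i iN => [|[|m]] iN; rewrite ?[dec_sum _ 0]dec_sum_small ?[dec_sum _ 1]dec_sum_small //.
  - by rewrite !addr0.
  - by rewrite !addr0 /perm_coef sep_sum1.
  by rewrite add0r /perm_coef sep_sum_split.
(* Here ['X%:P] is t and the outer ['X] is x. As P (1 + S) = S^2 and M (1 + t S) = t S^2,
   multiplying S = x + P + M by (1 + S) (1 + t S) eliminates P and M; the witness collects the error
   terms. *)
exists (r * (1 + 'X%:P * S) + s * (1 + S) + u * (1 + S) * (1 + 'X%:P * S)).
have rE' : r * 'X^N = P - (S - P) * S by rewrite {1}rE; ring.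
have sE' : s * 'X^N = M - 'X%:P * ((S - M) * S) by rewrite {1}sE; ring.
have uE' : u * 'X^N = S - ('X + P + M) by rewrite {1}uE; ring.
have -> : (r * (1 + 'X%:P * S) + s * (1 + S) + u * (1 + S) * (1 + 'X%:P * S)) * 'X^N
   = r * 'X^N * (1 + 'X%:P * S) + s * 'X^N * (1 + S)
     + u * 'X^N * (1 + S) * (1 + 'X%:P * S) by ring.
rewrite rE' sE' uE'; ring.
Qed.

Lemma gf_tree N :
  let S := 'X * gf N tree_sum in
  eqpX N ((1 - 'X%:P * S ^+ 2) * S) ('X * (1 + S) * (1 + 'X%:P * S)).
Proof.
move=> S; pose E := gf N even_sum; pose O := gf N odd_sum; pose T := gf N tree_sum.
have [r rE] : eqpX N O ('X * (T * E)).
  apply: eqpX_coef => -[|i] iN; rewrite coef_gf // coefXM ?odd_sum0 //=.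
  by rewrite coef_gfM ?odd_sumS // ltnW.
have [s sE] : eqpX N E (1 + 'X%:P * ('X * (T * O))).
  apply: eqpX_coef => -[|i] iN; rewrite coef_gf // coefD coefCM coefXM coef1 /=.
    by rewrite even_sum0 mulr0 addr0.
  by rewrite coef_gfM ?even_sumS ?add0r // ltnW.
have [u uE] : eqpX N T ((1 + 'X)%:P * O + 2%:R%:P * E - 1).
  apply: eqpX_coef => -[|i] iN; rewrite coefB coefD !coefCM !coef_gf // coef1 /=.
    by rewrite tree_sum0 even_sum0 odd_sum0; ring.
  by rewrite subr0 tree_sumS.
have rE' : r * 'X^N = O - 'X * (T * E) by rewrite {1}rE; ring.
have sE' : s * 'X^N = E - (1 + 'X%:P * ('X * (T * O))) by rewrite {1}sE; ring.
have uE' : u * 'X^N = T - ((1 + 'X)%:P * O + 2%:R%:P * E - 1) by rewrite {1}uE; ring.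
(* Elimination gives (1 - t S^2) O = S and (1 - t S^2) E = 1, with errors [r + S * s] and
   [s + 'X%:P * S * r]; both enter T = (1 + t) O + 2 E - 1, multiplied by x (1 - t S^2). *)
exists ('X * ((1 - 'X%:P * S ^+ 2) * u + (1 + 'X)%:P * (r + S * s)
   + 2%:R%:P * (s + 'X%:P * S * r))).
have -> : 'X * ((1 - 'X%:P * S ^+ 2) * u + (1 + 'X)%:P * (r + S * s)
   + 2%:R%:P * (s + 'X%:P * S * r)) * 'X^N
   = 'X * ((1 - 'X%:P * S ^+ 2) * (u * 'X^N) + (1 + 'X)%:P * (r * 'X^N + S * (s * 'X^N))
   + 2%:R%:P * (s * 'X^N + 'X%:P * S * (r * 'X^N))) by ring.
rewrite rE' sE' uE' /S -/T; ring.
Qed.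

Lemma sep_sum_tree_sum n : sep_sum des_weight n.+1 = tree_sum n.
Proof.
pose S := gf n.+2 perm_coef; pose S' := drop_poly 1 S.
(* S has no constant term, so it has the form ['X * p] required by [eqpX_unique]; precision [n.+2]
   keeps the coefficient of degree [n.+1]. *)
have SE : S = 'X * S'.
  rewrite -[LHS](poly_take_drop 1) mulrC expr1 [take_poly _ _](_ : _ = 0) ?add0r //.
  by apply/polyP => -[|i]; rewrite coef_take_poly coef0 // coef_gf.
have H := gf_perm n.+2; rewrite /= -/S SE in H.
have := coef_eqpX (eqpX_unique H (gf_tree n.+2)) (ltnSn n.+1).
by rewrite -SE coef_gf // coefXM /= coef_gf.
Qed.

(** * Uniqueness of the gamma coefficients *)

(** The system is unitriangular: the coefficient of t^k is [g k] plus a combination of the [g j]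
    with j < k. *)
Lemma gamma_expansion_inj n (g h : nat -> int) :
  gamma_expansion n g = gamma_expansion n h ->
  forall k, (k <= (n.-1)./2)%N -> g k = h k.
Proof.
move=> E k; elim/ltn_ind: k => k IH kn.
have coefE (a : nat -> int) : (gamma_expansion n a)`_k =
    a k + \sum_(j < (n.-1)./2.+1 | (j < k)%N)
       a j * ((1 + 'X) ^+ (n.-1 - j.*2) : {poly int})`_(k - j).
  rewrite /gamma_expansion coef_sum (bigID (fun j : 'I_ _ => (j < k)%N)) /= addrC.
  have c j : (((a j)%:P * 'X ^+ j * (1 + 'X) ^+ (n.-1 - j.*2)) : {poly int})`_k =
     if (k < j)%N then 0 else a j * ((1 + 'X) ^+ (n.-1 - j.*2) : {poly int})`_(k - j).
    by rewrite -mulrA coefCM coefXnM; case: ifP => // _; rewrite mulr0.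
  congr (_ + _); last by apply: eq_bigr => j jk; rewrite c ltnNge ltnW.
  have kn' : (k < (n.-1)./2.+1)%N by [].
  rewrite (bigD1 (Ordinal kn')) /= ?ltnn // c ltnn subnn.
  rewrite -horner_coef0 horner_exp !hornerE expr1n mulr1 big1 ?addr0 // => j /andP[].
  rewrite -leqNgt -val_eqE /= c => kj jk; rewrite ifT //; lia.
have := congr1 (fun p : {poly int} => p`_k) E; rewrite /= !coefE.
rewrite [X in _ + X = _](_ : _ = \sum_(j < (n.-1)./2.+1 | (j < k)%N)
   h j * ((1 + 'X) ^+ (n.-1 - j.*2) : {poly int})`_(k - j)); first exact: addIr.
by apply: eq_bigr => j jk; rewrite IH //; lia.
Qed.
Local Close Scope ring_scope.

(* ts is any duplicate-free enumeration of T_n (binary trees with n-1 nodes). *)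
Theorem theorem5p7 (n : nat) (ts : seq btree) :
  (1 <= n)%N -> uniq ts -> (forall t : btree, (t \in ts) = (nnodes t == n.-1)) ->
  des_poly n = gamma_expansion n (fun k => Posz (gammaT n ts k)) /\
  (forall gamma : nat -> int, des_poly n = gamma_expansion n gamma ->
     forall k : nat, (k <= (n.-1)./2)%N -> gamma k = Posz (gammaT n ts k)).
Proof.
move=> n0 uts mts.
have E : des_poly n = gamma_expansion n (fun k => Posz (gammaT n ts k)).
  rewrite gamma_expansion_trees // des_poly_sep_sum.
  by case: n n0 {mts} => // n _; apply: sep_sum_tree_sum.
by split=> // gamma; rewrite E => /esym; apply: gamma_expansion_inj.
Qed.
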